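(* Let $n$ be a positive integer. If $\Phi_{2}=t+1$ is a factor of $Q_{2n}(t)$, then $\Phi_{2}$ is a double factor of $Q_{2n}(t)$, that is, $\Phi_2^2$ divides $Q_{2n}(t)$.
   Context: For a permutation $\pi$ in the symmetric group $\mathfrak{S}_n$, its descent set is $\mathrm{Des}(\pi)=\{i\in[n-1] : \pi_i>\pi_{i+1}\}$, where $[n-1]=\{1,\dots,n-1\}$. For $S\subseteq[n-1]$ let $\beta_n(S)=|\{\pi\in\mathfrak{S}_n : \mathrm{Des}(\pi)=S\}|$. The $n$th descent set polynomial is $Q_n(t)=\sum_{S\subseteq[n-1]}t^{\beta_n(S)}$. $\Phi_m(t)$ denotes the $m$th cyclotomic polynomial; factors are in $\mathbb{Q}[t]$. *)

(* Defs.v *)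
From mathcomp Require Import all_boot all_order all_fingroup all_algebra all_field.

Set Implicit Arguments.
Unset Strict Implicit.
Unset Printing Implicit Defensive.

Import GRing.Theory.
Local Open Scope ring_scope.

(* Everything is 0-based: a permutation acts on {0, ..., n-1}, and i : 'I_n.-1
   stands for the position i+1 of [n-1], comparing the consecutive entries at
   0-based places i and i+1. *)
Definition pos_left n (i : 'I_n.-1) : 'I_n := widen_ord (leq_pred n) i.

Fact pos_right_subproof n (i : 'I_n.-1) : (i.+1 < n)%N.
Proof. by rewrite -ltn_predRL. Qed.

Definition pos_right n (i : 'I_n.-1) : 'I_n := Ordinal (pos_right_subproof i).

Definition Des n (s : 'S_n) : {set 'I_n.-1} :=
  [set i | (s (pos_right i) < s (pos_left i))%N].

Definition beta n (S : {set 'I_n.-1}) : nat := #|[set s : 'S_n | Des s == S]|.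

Definition descent_poly n : {poly rat} :=
  \sum_(S : {set 'I_n.-1}) 'X^(beta S).

Definition Phi m : {poly rat} := map_poly intr 'Phi_m.

Lemma Phi2E : Phi 2 = 'X + 1.
Proof.
have P1 : 'Phi_1 = 'X - 1.
  by have := @prod_Cyclotomic 1 isT; rewrite big_seq1 expr1.
have := @prod_Cyclotomic 2 isT.
rewrite (_ : divisors 2 = [:: 1%N; 2%N]) // big_cons big_seq1 P1.
rewrite -[1 in RHS](expr1n _ 2) subr_sqr => /mulfI P2.
rewrite /Phi P2 ?rmorphD ?rmorph1 /= ?map_polyX //.
by rewrite -polyC1 polyXsubC_eq0.
Qed.

(* Main.v *)
Require Import Defs.
From mathcomp Require Import all_boot all_order all_fingroup all_algebra all_field.
From mathcomp Require Import zify.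

(** Positions are odd or even according to their 1-based index. Exchanging the
    contents of places 2j and 2j+1 toggles the descent at the even position 2j
    and fixes the other even ones, so the even part of the descent set of a
    uniform permutation is uniform. On the other hand the parity of beta S only
    depends on the even part of S: for i odd, some pair of values 2k-1, 2k is
    separated by the cut at i, and exchanging the values of such a pair
    preserves all descents except possibly at i, whence beta S + beta S' is even
    for S' obtained from S by toggling i. Therefore -Q'(-1), which is the sum of
    (-1)^(beta (Des s)) over all permutations s, is a multiple of Q(-1). *)

Set Implicit Arguments.
Unset Strict Implicit.
Unset Printing Implicit Defensive.

Import GRing.Theory Num.Theory.
Local Open Scope ring_scope.

(** * Symmetric difference with a singleton *)

Section Toggle.
Variable I : finType.
Implicit Types (i j : I) (S T E : {set I}).

Definition toggle i S := [set j | (j \in S) (+) (j == i)].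

Lemma in_toggle i S j : (j \in toggle i S) = (j \in S) (+) (j == i).
Proof. by rewrite inE. Qed.

Lemma toggleK i : involutive (toggle i).
Proof. by move=> S; apply/setP=> j; rewrite !in_toggle addbK. Qed.

Lemma toggle_in i S : i \in S -> toggle i S = S :\ i.
Proof.
move=> iS; apply/setP=> j; rewrite in_toggle !inE.
by case: eqP => [->|_]; rewrite ?iS // addbF.
Qed.

Lemma setD1_eq_toggle i S T :
  (T :\ i == S :\ i) = (T == S) || (T == toggle i S).
Proof.
apply/eqP/orP => [/setP eqT|[]/eqP-> //]; last first.
  by apply/setP=> j; rewrite !inE; case: eqVneq => //=; rewrite addbF.
have [eqi|neqi] := eqVneq (i \in T) (i \in S); [left|right];
  apply/eqP/setP=> j; have := eqT j; rewrite !inE;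
  have [->|] //= := eqVneq j i; rewrite ?addbF //.
by move: neqi; case: (i \in T); case: (i \in S).
Qed.

Lemma toggleI_notin i S E : i \notin E -> toggle i S :&: E = S :&: E.
Proof.
move=> iE; apply/setP=> j; rewrite !inE.
by case: eqP => [->|_]; rewrite ?(negbTE iE) ?andbF // addbF.
Qed.

Lemma toggleI_in i S E : i \in E -> toggle i S :&: E = toggle i (S :&: E).
Proof.
move=> iE; apply/setP=> j; rewrite !inE.
by case: eqP => [->|_]; rewrite ?iE ?andbT // !addbF.
Qed.

(** The elements of [S] outside [E] can be toggled away one at a time, so [f S = f (S :&: E)]. *)
Lemma toggle_invariant (U : Type) (f : {set I} -> U) E :
    (forall i S, i \notin E -> f (toggle i S) = f S) ->
  forall S T, S :&: E = T :&: E -> f S = f T.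
Proof.
move=> fE; have fI S : f S = f (S :&: E).
  have [k] := ubnP #|S :\: E|; elim: k S => // k IHk S leSk.
  have [SE|[i iSE]] := set_0Vmem (S :\: E).
    by congr f; rewrite -[LHS](setID S E) SE setU0.
  have [iS iE] := setDP iSE.
  rewrite -(fE i S iE) IHk ?toggleI_notin // toggle_in //.
  by rewrite setDDl setUC -setDDl; rewrite (cardsD1 i) iSE in leSk.
by move=> S T eqST; rewrite fI eqST -fI.
Qed.

Lemma card_trace_const E S :
  #|[set T | T :&: E == S :&: E]| = #|[set T | T :&: E == set0]|.
Proof.
(* With the empty set as [E], invariance under all toggles makes the count constant. *)
suff /toggle_invariant-/(_ S set0 _) -> :
    forall i S, i \notin (set0 : {set I}) ->
    #|[set T | T :&: E == toggle i S :&: E]| = #|[set T | T :&: E == S :&: E]|.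
- by rewrite set0I.
- by rewrite !setI0.
move=> {S} i S _; have [iE|iE] := boolP (i \in E); last by rewrite toggleI_notin.
rewrite -(card_preimset _ (inv_inj (toggleK i))); apply: eq_card => T.
by rewrite !inE !toggleI_in // (inj_eq (inv_inj (toggleK i))).
Qed.

End Toggle.

Lemma even_card_involution (T : finType) (f : T -> T) (A : {set T}) :
    involutive f -> (forall x, x \in A -> f x != x) ->
    (forall x, x \in A -> f x \in A) ->
  ~~ odd #|A|.
Proof.
move=> fK; have [k] := ubnP #|A|; elim: k A => // k IHk A leAk fA AfA.
have [->|[x xA]] := set_0Vmem A; first by rewrite cards0.
have fxA : f x \in A :\ x by rewrite !inE fA //= AfA.
have cA : #|A| = #|A :\ x :\ f x|.+2.
  by rewrite (cardsD1 x A) xA (cardsD1 (f x) (A :\ x)) fxA.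
rewrite cA /= negbK.
apply: IHk; first by lia.
  by move=> y; rewrite !inE => /and3P[_ _ /fA].
move=> y; rewrite !inE => /and3P[yfx yx /AfA ->].
by rewrite (inj_eq (inv_inj fK)) yx -(inj_eq (inv_inj fK)) fK yfx.
Qed.

Lemma mate_subproof n (x : 'I_n) :
  ((if odd n then x : nat else if odd x then x.-1 else x.+1) < n)%N.
Proof. by have := ltn_ord x; case: ifP => // n_even; case: ifP; lia. Qed.

(* Meaningful for n even; the branch for n odd is junk keeping values below n. *)
Definition mate n (x : 'I_n) : 'I_n := Ordinal (mate_subproof x).

(** * Parity of [beta] under toggling an odd position *)

Section ParityOfBeta.
Variables (n : nat) (i : 'I_n.-1).
Hypotheses (n_even : ~~ odd n) (i_even : ~~ odd i).
Implicit Types (x y : 'I_n) (s : 'S_n).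

Lemma val_mate x : mate x = (if odd x then x.-1 else x.+1) :> nat.
Proof. by rewrite /= (negbTE n_even). Qed.

Lemma mateK : involutive (@mate n).
Proof.
move=> x; apply: val_inj; rewrite /= (negbTE n_even).
by case: ifP; case: ifP; lia.
Qed.

Lemma mate_neq x : mate x != x.
Proof. by rewrite -val_eqE /= (negbTE n_even); case: ifP; lia. Qed.

(** Mates are consecutive values, so any third value compares alike with both. *)
Lemma tperm_mate_lt x y z : (y, z) != (x, mate x) -> (y, z) != (mate x, x) ->
  (tperm x (mate x) y < tperm x (mate x) z)%N = (y < z)%N.
Proof.
rewrite !xpair_eqE -!val_eqE; have := val_mate x; move: (mate x) => x' Ex.
have {Ex} : x' = x.+1 :> nat \/ x = x'.+1 :> nat by rewrite Ex; case: ifP; lia.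
by case: tpermP => [->|->|/eqP + /eqP +]; case: tpermP => [->|->|/eqP + /eqP +];
  rewrite -?val_eqE /=; lia.
Qed.

Definition separated s x :=
  (((s^-1)%g x <= i) != ((s^-1)%g (mate x) <= i))%N.

(** Otherwise [mate] would act without fixed points on the values in the first [i.+1] places, whose
    number is odd. *)
Lemma separated_ex s : exists x, separated s x.
Proof.
apply/existsP; apply: contraT => /existsPn nsep.
have: ~~ odd #|[set x | ((s^-1)%g x <= i)%N]|.
  apply: (@even_card_involution _ (@mate n)); first exact: mateK.
    by move=> x _; apply: mate_neq.
  by move=> x; have := nsep x; rewrite negbK !inE => /eqP <-.
have -> : [set x | ((s^-1)%g x <= i)%N] = s @: [set x : 'I_n | (x < i.+1)%N].
  apply/setP=> x; rewrite -[x in RHS](permKV s) mem_imset ?inE //.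
  exact: perm_inj.
rewrite card_imset; last exact: perm_inj.
have le_i : (i.+1 <= n)%N by have := ltn_ord i; lia.
rewrite -sum1dep_card -(big_ord_widen _ (fun _ => 1%N) le_i) sum1_card card_ord.
by rewrite /= negbK (negbTE i_even).
Qed.

(** Products compose left to right, so the right factor exchanges values. The default [s] is never
    reached, by [separated_ex]. *)
Definition mate_swap s : 'S_n :=
  if [pick x | separated s x] is Some x then (s * tperm x (mate x))%g else s.

(** Exchanging mates only swaps the two sides of the cut for that pair. Hence [pick] selects the
    same [x] again, and [mate_swap] is an involution. *)
Lemma separated_swap s x y : separated s x ->
  separated (s * tperm x (mate x))%g y = separated s y.
Proof.
rewrite /separated invMg tpermV !permM => sep_x.
have [->|yx] := eqVneq y x; first by rewrite tpermL tpermR eq_sym.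
have [->|yx'] := eqVneq y (mate x).
  by rewrite mateK tpermL tpermR eq_sym.
rewrite !tpermD 1?eq_sym // ?(inj_eq (inv_inj mateK)) //.
by rewrite -(inj_eq (inv_inj mateK)) mateK.
Qed.

Lemma mate_swapK : involutive mate_swap.
Proof.
move=> s; rewrite {2}/mate_swap; case Ex: [pick x | separated s x] => [x|].
  have sep_x : separated s x by case: pickP Ex => // y ? [<-].
  rewrite /mate_swap (eq_pick (fun y => separated_swap y sep_x)) Ex.
  by rewrite -mulgA tperm2 mulg1.
by rewrite /mate_swap Ex.
Qed.

Lemma mate_swap_neq s : mate_swap s != s.
Proof.
rewrite /mate_swap; case: pickP => [x _|nsep]; last first.
  by have [x] := separated_ex s; rewrite nsep.
apply/eqP=> /(canRL (mulKg s)); rewrite mulVg => /permP/(_ x).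
by rewrite tpermL perm1; apply/eqP/mate_neq.
Qed.

Lemma Des_mate_swap s : Des (mate_swap s) :\ i = Des s :\ i.
Proof.
rewrite /mate_swap; case: pickP => // x sep_x.
apply/setP=> j; rewrite !inE; case: eqVneq => //= ji; rewrite !permM.
have nsep a b : (s a, s b) = (x, mate x) -> (a <= i)%N != (b <= i)%N.
  by case=> sa sb; move: sep_x; rewrite /separated -sb -sa !permK.
(* Only the adjacent places at [i] straddle the cut, so those at [j] cannot hold the separated
   pair. *)
have side : ((pos_right j <= i) = (pos_left j <= i))%N.
  by apply/idP/idP => /=; move: ji; rewrite -val_eqE /=; lia.
apply: tperm_mate_lt; apply/eqP.
  by move/nsep; rewrite side eqxx.
by case=> sr sl; have := @nsep (pos_left j) (pos_right j);
  rewrite sr sl side eqxx => /(_ erefl).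
Qed.

(** [mate_swap] pairs off the permutations counted by [beta S + beta (toggle i S)]. *)
Lemma odd_beta_toggle (S : {set 'I_n.-1}) :
  odd (beta (toggle i S)) = odd (beta S).
Proof.
have : ~~ odd #|[set s | Des s :\ i == S :\ i]|.
  apply: (even_card_involution mate_swapK) => s; first by rewrite mate_swap_neq.
  by rewrite !inE Des_mate_swap.
have -> : [set s | Des s :\ i == S :\ i] =
          [set s | Des s == S] :|: [set s | Des s == toggle i S].
  by apply/setP=> s; rewrite !inE setD1_eq_toggle.
rewrite cardsU (_ : _ :&: _ = set0) ?cards0 ?subn0; last first.
  apply/setP=> s; rewrite !inE; apply/negP=> /andP[/eqP-> /eqP/setP/(_ i)].
  by rewrite in_toggle eqxx addbT; case: (i \in S).
by rewrite oddD -/(beta S) -/(beta (toggle i S)) negb_add => /eqP->.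
Qed.

End ParityOfBeta.

(** * Uniformity of the even part of the descent set *)

Section Equidistribution.
Variables (n : nat).
Implicit Types (s : 'S_n) (S T : {set 'I_n.-1}).

(* The index i stands for the position i+1, hence the parity shift. *)
Definition evens : {set 'I_n.-1} := [set i : 'I_n.-1 | odd i].

Lemma card_Des_trace_const S :
  #|[set s | Des s :&: evens == S :&: evens]| =
  #|[set s | Des s :&: evens == set0]|.
Proof.
suff /toggle_invariant-/(_ S set0 _) -> :
    forall i S, i \notin (set0 : {set 'I_n.-1}) ->
    #|[set s | Des s :&: evens == toggle i S :&: evens]|
    = #|[set s | Des s :&: evens == S :&: evens]|.
- by rewrite set0I.
- by rewrite !setI0.
move=> i {}S _; have [iE|iE] := boolP (i \in evens); last by rewrite toggleI_notin.
(* The left factor exchanges places. Another even position is at distance at least 2 from [i], so it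
   compares neither of these places. *)
have DesT s : Des (tperm (pos_left i) (pos_right i) * s)%g :&: evens =
              toggle i (Des s :&: evens).
  apply/setP=> j; rewrite !inE !permM.
  move: iE; rewrite inE => i_odd.
  have [->|ji] := eqVneq j i.
    rewrite tpermL tpermR i_odd !andbT addbT -leqNgt ltn_neqAle.
    by rewrite val_eqE (inj_eq perm_inj) -val_eqE /= ltn_eqF ?ltnSn.
  rewrite addbF; have [j_odd|] := boolP (odd j); rewrite ?andbF // !andbT.
  by rewrite !tpermD // -val_eqE /=; move: ji; rewrite -val_eqE /=; lia.
rewrite -(card_preimset _ (mulgI (tperm (pos_left i) (pos_right i)))).
apply: eq_card => s; rewrite !inE DesT toggleI_in //.
by rewrite (inj_eq (inv_inj (@toggleK _ i))).
Qed.

Lemma sum_Des_eq0 (R : numDomainType) (g : {set 'I_n.-1} -> R) :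
    (forall S T, S :&: evens = T :&: evens -> g S = g T) ->
  \sum_S g S = 0 -> \sum_s g (Des s) = 0.
Proof.
move=> gE sum0; pose K := #|[set S : {set 'I_n.-1} | S :&: evens == set0]|.
have K_gt0 : (0 < K)%N by apply/card_gt0P; exists set0; rewrite inE set0I.
suff /eqP : (\sum_s g (Des s)) *+ K = 0.
  by rewrite mulrn_eq0 eqn0Ngt K_gt0 => /eqP.
(* Double counting of pairs [(s, S)] with the same even part: each [s] meets [K] sets, each [S]
   meets [c] permutations. *)
transitivity (\sum_s \sum_(S | S :&: evens == Des s :&: evens) g S).
  rewrite -sumrMnl; apply: eq_bigr => s _.
  rewrite (eq_bigr (fun=> g (Des s))) => [|S /eqP/gE //].
  by rewrite sumr_const /K -(card_trace_const _ (Des s)); congr (_ *+ _);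
    apply: eq_card => S; rewrite !inE.
rewrite (exchange_big_dep predT) //=.
pose c := #|[set s | Des s :&: evens == set0]|.
transitivity (\sum_S g S *+ c); last by rewrite sumrMnl sum0 mul0rn.
apply: eq_bigr => S _; rewrite sumr_const /c -(card_Des_trace_const S).
by congr (_ *+ _); apply: eq_card => s; rewrite !inE eq_sym.
Qed.

End Equidistribution.

(** If [p = q * ('X + 1)], then [p^]() = q^[() * ('X + 1) + q], so ['X + 1] divides [q]. *)
Lemma dvdp_sqrXaddC1 (F : fieldType) (p : {poly F}) :
  root p (-1) -> root p^`() (-1) -> ('X + 1) ^+ 2 %| p.
Proof.
have -> : 'X + 1 = 'X - (-1)%:P :> {poly F} by rewrite polyCN opprK.
rewrite !root_factor_theorem => /dvdpP[q ->].
rewrite derivM derivXsubC mulr1 dvdp_addr ?dvdp_mulIr //.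
by move=> dvd_q; rewrite expr2 dvdp_mul2r // polyXsubC_eq0.
Qed.

Theorem theorem7p2 (n : nat) (hn : (0 < n)%N) :
  Phi 2 %| descent_poly (2 * n)%N -> Phi 2 ^+ 2 %| descent_poly (2 * n)%N.
Proof.
set m := (2 * n)%N; have m_even : ~~ odd m by rewrite oddM.
rewrite Phi2E => dvdQ.
pose g (S : {set 'I_m.-1}) : rat := (-1) ^+ beta S.
have rootQ : root (descent_poly m) (-1).
  by rewrite root_factor_theorem polyCN opprK.
apply: dvdp_sqrXaddC1 => //; apply/rootP.
have sum0 : \sum_S g S = 0.
  transitivity (descent_poly m).[-1]; last exact/rootP.
  by rewrite horner_sum; apply: eq_bigr => S _; rewrite hornerXn.
have gE S T : S :&: evens m = T :&: evens m -> g S = g T.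
  apply: toggle_invariant S T => i S; rewrite inE => i_even.
  by rewrite /g -signr_odd odd_beta_toggle // signr_odd.
have := sum_Des_eq0 gE sum0.
(* Grouping by descent set gives the sum of [beta S * (-1) ^ beta S], which is minus the derivative
   at -1. *)
rewrite (partition_big (@Des m) predT) //= => sum0'.
rewrite raddf_sum horner_sum /= -[RHS]oppr0 -[in RHS]sum0' -sumrN.
apply: eq_bigr => S _; rewrite (eq_bigr (fun=> g S)) => [|s /eqP-> //].
rewrite sumr_const (_ : #|_| = beta S); last first.
  by apply: eq_card => s; rewrite !inE.
rewrite derivXn hornerMn hornerXn /g -mulNrn.
(* The derivative has exponent [(beta S).-1], so the sign shift needs [beta S] positive; at 0 both
   terms vanish. *)
by case: (beta S) => [|b]; rewrite ?mulr0n // exprS mulN1r opprK.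
Qed.
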